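(* Let $p$ be a prime, $R\subseteq\mathbb{F}_p$ the set of quadratic residues and $A\subseteq\mathbb{F}_p$. If $A+A=R$, then $p=3$ and $A=\{2\}$. Moreover, for every $\varepsilon>0$ there is $p_0$ such that for every prime $p>p_0$ and every $A\subseteq\mathbb{F}_p$, $$\max\Big\{|R\setminus(A+A)|,\ \sum_{x\in(A+A)\setminus R}(A*A)(x)\Big\}\ \ge\ \Big(\tfrac16-\varepsilon\Big)|A|.$$
   Context: $R$ is the set of nonzero squares in $\mathbb{F}_p$; $A+A=\{a+a': a,a'\in A\}$; $(A*A)(x)=\sum_{y}A(y)A(x-y)$, i.e. the number of pairs $(a,a')\in A^2$ with $a+a'=x$. *)

(* Defs.v *)
From mathcomp Require Import all_boot all_order all_algebra.

Set Implicit Arguments.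
Unset Strict Implicit.
Unset Printing Implicit Defensive.

Import GRing.Theory.
Local Open Scope ring_scope.

Definition quad_residues (F : finFieldType) : {set F} :=
  [set x | (x != 0) && [exists y, x == y ^+ 2]].

Definition sumset (G : finZmodType) (A B : {set G}) : {set G} :=
  [set a + b | a in A, b in B].

(* [A * B] for the indicator functions of A and B, with values in [nat]. *)
Definition convolution (G : finZmodType) (A B : {set G}) (x : G) : nat :=
  (\sum_(y : G) (y \in A) * ((x - y)%R \in B))%N.

(* Main.v *)
Require Import Defs.
From mathcomp Require Import all_boot all_order all_algebra.
From mathcomp Require Import reals.
From mathcomp Require Import zify ring lra.

(** Let [chi] be the quadratic character, [k = |A|] and
    [f x = \sum_(a in A) chi (x + a)].  Then [f] has mean zero and
    [\sum_x f x ^ 2 = p k - k ^ 2].  If [A + A] is nearly contained in [R], then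
    [f] is about [k] on [A], and those [x] contribute about [k ^ 3] to the second
    moment.  Since [f] is integer valued with mean zero, the [x] outside [A]
    contribute at least [\sum_(x notin A) - f x = \sum_(x in A) f x], about
    [k ^ 2].  Hence [k ^ 2 + 2 k] is at most about [p], whereas [A + A] covering
    nearly all of [R] requires [k ^ 2 + k >= p - 1] up to an error. *)

Set Implicit Arguments.
Unset Strict Implicit.
Unset Printing Implicit Defensive.

Import Order.TTheory GRing.Theory Num.Theory.
Local Open Scope ring_scope.

Section Character.
Variable F : finFieldType.
Implicit Types (x y c : F) (A : {set F}).

(** * Square-root counts and correlations of the quadratic character *)

Definition nb_sqrt x : int := \sum_y (y ^+ 2 == x)%:R.

(* The quadratic character of [F] when [2 != 0]. *)
Definition quad_char x : int := nb_sqrt x - 1.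

Definition shifted_char_sum A x : int := \sum_(a in A) quad_char (x + a).

(** Pairs count with multiplicity, so that for [B = R] this is the second quantity of the
    maximum. *)
Definition pairs_outside A (B : {set F}) : int :=
  \sum_(a in A) \sum_(b in A) (a + b \notin B)%:R.

Lemma sum_delta (I : finType) (i : I) (g : I -> int) :
  \sum_j (i == j)%:R * g j = g i.
Proof.
rewrite (bigD1 i) //= eqxx mul1r big1 ?addr0 // => j.
by rewrite eq_sym => /negPf ->; rewrite mul0r.
Qed.

Lemma sum_const (I : finType) (B : {set I}) (c : int) :
  \sum_(i in B) c = #|B|%:R * c.
Proof. by rewrite sumr_const mulr_natl. Qed.

Lemma sum_constT (I : finType) (c : int) : \sum_(i : I) c = #|I|%:R * c.
Proof. by rewrite sumr_const mulr_natl. Qed.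

Lemma sum_nb_sqrt : \sum_x nb_sqrt x = #|F|%:R.
Proof.
rewrite exchange_big /= (eq_bigr (fun=> 1)) ?sum_constT ?mulr1 // => y _.
by rewrite -[RHS](sum_delta (y ^+ 2) (fun=> 1)); apply: eq_bigr => x _; rewrite mulr1.
Qed.

Lemma nb_sqrt_ge0 x : 0 <= nb_sqrt x.
Proof. by apply: sumr_ge0 => y _; case: (_ == _). Qed.

Lemma quad_char_geN1 x : -1 <= quad_char x.
Proof. by have := nb_sqrt_ge0 x; rewrite /quad_char; lia. Qed.

Lemma sum_quad_char : \sum_x quad_char x = 0.
Proof. by rewrite sumrB sum_nb_sqrt sum_constT mulr1 subrr. Qed.

Lemma sum_quad_char_shift c : \sum_x quad_char (x + c) = 0.
Proof.
rewrite -[RHS]sum_quad_char [RHS](reindex_inj (addIr c)) /=.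
exact: eq_bigr.
Qed.

Lemma sum_shifted_char_sum A : \sum_x shifted_char_sum A x = 0.
Proof. by rewrite exchange_big big1 // => a _; rewrite sum_quad_char_shift. Qed.

Hypothesis two_neq0 : 2%:R != 0 :> F.

(* Substituting [z = y + u], each [u != 0] determines [y]. *)
Lemma sum_nb_sqrt_shift c :
  \sum_x nb_sqrt x * nb_sqrt (x + c) = #|F|%:R - 1 + (c == 0)%:R * #|F|%:R.
Proof.
have -> : \sum_x nb_sqrt x * nb_sqrt (x + c) = \sum_y nb_sqrt (y ^+ 2 + c).
  rewrite (eq_bigr (fun x => \sum_y (y ^+ 2 == x)%:R * nb_sqrt (x + c))).
    by rewrite exchange_big; apply: eq_bigr => y _; rewrite sum_delta.
  by move=> x _; rewrite mulr_suml.
have -> : \sum_y nb_sqrt (y ^+ 2 + c)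
        = \sum_u \sum_y ((y + u) ^+ 2 == y ^+ 2 + c)%:R.
  rewrite [RHS]exchange_big; apply: eq_bigr => y _.
  by rewrite /nb_sqrt (reindex_inj (addrI y)).
rewrite (bigD1 0) //= addrC; congr (_ + _).
  rewrite (eq_bigr (fun=> 1)); last first.
    move=> u u0; rewrite -[RHS](sum_delta ((c - u ^+ 2) / (2%:R * u)) (fun=> 1)).
    apply: eq_bigr => y _; rewrite mulr1; congr (nat_of_bool _)%:R.
    apply/eqP/eqP => [E|<-]; last by field; rewrite u0 two_neq0.
    have -> : c = (y + u) ^+ 2 - y ^+ 2 by rewrite E; ring.
    by field; rewrite u0 two_neq0.
  have := sum_constT F 1; rewrite mulr1 (bigD1 (0 : F)) //= => <-.
  by rewrite addrC addrK.
rewrite (eq_bigr (fun=> (c == 0)%:R)) ?sum_constT 1?mulrC // => y _.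
by rewrite addr0 -{1}[y ^+ 2]addr0 (inj_eq (addrI _)) eq_sym.
Qed.

(** Expanding [nb_sqrt - 1] in both factors leaves the point count of the conic
    [z ^ 2 - y ^ 2 = c]. *)
Lemma sum_quad_char_corr c :
  \sum_x quad_char x * quad_char (x + c) = (c == 0)%:R * #|F|%:R - 1.
Proof.
have -> : \sum_x quad_char x * quad_char (x + c)
    = \sum_x (nb_sqrt x * nb_sqrt (x + c) - quad_char x - quad_char (x + c) - 1).
  by apply: eq_bigr => x _; rewrite /quad_char; ring.
rewrite 3!sumrB sum_nb_sqrt_shift sum_quad_char sum_quad_char_shift sum_constT.
ring.
Qed.

Lemma sum_sqr_shifted_char_sum A :
  \sum_x shifted_char_sum A x ^+ 2 = #|F|%:R * #|A|%:R - #|A|%:R ^+ 2.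
Proof.
have corr a b : \sum_x quad_char (x + a) * quad_char (x + b)
               = (a == b)%:R * #|F|%:R - 1.
  (* Translating by [- a] leaves only the shift [b - a]. *)
  rewrite (reindex_inj (addIr (- a))) /= eq_sym -[b == a]subr_eq0.
  rewrite -sum_quad_char_corr; apply: eq_bigr => x _.
  by rewrite addrNK -addrA [- a + b]addrC.
have -> : \sum_x shifted_char_sum A x ^+ 2
    = \sum_(a in A) \sum_(b in A) ((a == b)%:R * #|F|%:R - 1).
  under eq_bigr => x _ do rewrite expr2 mulr_suml.
  rewrite exchange_big; apply: eq_bigr => a _.
  under eq_bigr => x _ do rewrite mulr_sumr.
  by rewrite exchange_big; apply: eq_bigr => b _; rewrite corr.
rewrite (eq_bigr (fun=> #|F|%:R - #|A|%:R)); last first.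
  move=> a aA; rewrite sumrB sum_const mulr1; congr (_ - _).
  rewrite (bigD1 a) //= eqxx mul1r big1 ?addr0 // => b /andP[_].
  by rewrite eq_sym => /negPf ->; rewrite mul0r.
by rewrite sum_const; ring.
Qed.

(** * Values at the quadratic residues *)

Lemma nb_sqrt_residue x : x \in quad_residues F -> nb_sqrt x = 2.
Proof.
rewrite inE => /andP[x0 /existsP[w /eqP xw]].
have w0 : w != 0 by apply: contraNneq x0 => w0; rewrite xw w0 expr0n.
have wN : - w != w.
  by rewrite -subr_eq0 -opprD oppr_eq0 -mulr2n -mulr_natl mulf_neq0.
rewrite /nb_sqrt xw (bigD1 w) //= (bigD1 (- w)) //= sqrrN !eqxx big1 // => y.
by move=> /andP[yw yNw]; rewrite eqf_sqr (negPf yw) (negPf yNw).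
Qed.

Lemma quad_char_residue x : x \in quad_residues F -> quad_char x = 1.
Proof. by move=> /nb_sqrt_residue; rewrite /quad_char => ->. Qed.

(** Sort the elements of [F] by their square: a residue has two roots, [0] has one, any other
    element none. *)
Lemma card_quad_residues : #|F| = (2 * #|quad_residues F| + 1)%N.
Proof.
suff : #|F|%:R = 2 * #|quad_residues F|%:R + 1 :> int by lia.
rewrite -sum_nb_sqrt (bigID (mem (quad_residues F))) /=; congr (_ + _).
  rewrite (eq_bigr (fun=> 2)) ?sum_const 1?mulrC // => x; exact: nb_sqrt_residue.
rewrite (bigD1 0) /=; last by rewrite inE eqxx.
rewrite [X in _ + X]big1 ?addr0.
  rewrite /nb_sqrt (bigD1 0) //= expr0n eqxx big1 // => y.
  by rewrite sqrf_eq0 => /negPf ->.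
move=> x /andP[]; rewrite inE => xR x0; rewrite /nb_sqrt big1 // => y _.
case: eqP => // yx; move: xR; rewrite x0 /= => /existsP[].
by exists y; rewrite yx.
Qed.

(** * The second-moment inequality *)

(** A pair with sum in [R] contributes exactly [1]; any other contributes at least [-1], a loss of
    at most [2]. *)
Lemma sum_shifted_char_sum_in_ge A :
  #|A|%:R ^+ 2 - 2 * pairs_outside A (quad_residues F)
    <= \sum_(x in A) shifted_char_sum A x.
Proof.
have -> : #|A|%:R ^+ 2 - 2 * pairs_outside A (quad_residues F)
  = \sum_(x in A) \sum_(a in A) (1 - 2 * (x + a \notin quad_residues F)%:R).
  rewrite /pairs_outside mulr_sumr expr2 -sum_const -sumrB.
  apply: eq_bigr => x _; rewrite mulr_sumr -[X in X - _]mulr1 -sum_const.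
  by rewrite -sumrB.
apply: ler_sum => x _; apply: ler_sum => a _.
have [/quad_char_residue ->|_] := boolP (x + a \in _); first by lia.
by have := quad_char_geN1 (x + a); lia.
Qed.

Lemma card_le_pairs_outside A :
  #|A|%:R ^+ 3 + 2 * #|A|%:R ^+ 2
    <= #|F|%:R * #|A|%:R
       + 2 * (2 * #|A|%:R + 1) * pairs_outside A (quad_residues F).
Proof.
set k : int := #|A|%:R; set m2 := pairs_outside _ _.
set S := \sum_(x in A) shifted_char_sum A x.
have geS : k ^+ 2 - 2 * m2 <= S by exact: sum_shifted_char_sum_in_ge.
have sumN : \sum_(x | x \notin A) shifted_char_sum A x = - S.
  have := sum_shifted_char_sum A; rewrite (bigID (mem A)) /= addrC.
  by move/eqP; rewrite addr_eq0 => /eqP.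
have inA : 2 * k * S - k ^+ 3 <= \sum_(x in A) shifted_char_sum A x ^+ 2.
  have -> : 2 * k * S - k ^+ 3
      = \sum_(x in A) (2 * k * shifted_char_sum A x - k ^+ 2).
    by rewrite sumrB sum_const -mulr_sumr -/S -/k; ring.
  apply: ler_sum => x _; rewrite -subr_ge0.
  rewrite (_ : _ - _ = (shifted_char_sum A x - k) ^+ 2) ?sqr_ge0 //; ring.
(* Integrality: [- n <= n ^ 2] for every integer [n]. *)
have notinA : S <= \sum_(x | x \notin A) shifted_char_sum A x ^+ 2.
  rewrite -[S]opprK -sumN -sumrN; apply: ler_sum => x _.
  have [|] := leP 0 (shifted_char_sum A x); rewrite expr2; nia.
have := sum_sqr_shifted_char_sum A; rewrite (bigID (mem A)) /= -/k => tot.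
have k0 : 0 <= 2 * k + 1 by rewrite addr_ge0 // mulr_ge0 // ler0n.
have := ler_wpM2l k0 geS; lra.
Qed.

(** * Convolution, sumset size and the combined bound *)

Lemma convolution_card A (x : F) :
  (convolution A A x)%:R = \sum_(a in A) (x - a \in A)%:R :> int.
Proof.
rewrite /convolution natr_sum [RHS]big_mkcond /=; apply: eq_bigr => y _.
by rewrite natrM; case: (y \in A); rewrite ?mul1r ?mul0r.
Qed.

Lemma sum_convolution A (B : pred F) :
  \sum_(x | B x) (convolution A A x)%:R
    = \sum_(a in A) \sum_(b in A) (B (a + b))%:R :> int.
Proof.
under eq_bigr => x _ do rewrite convolution_card.
rewrite exchange_big; apply: eq_bigr => a aA.
rewrite big_mkcond (reindex_inj (addrI a)) /= [RHS]big_mkcond /=.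
apply: eq_bigr => b _; rewrite [a + b]addrC addrK.
by case: (B _); case: (b \in A).
Qed.

Lemma sum_convolution_outside A (B : {set F}) :
  (\sum_(x in sumset A A :\: B) convolution A A x)%N%:R = pairs_outside A B.
Proof.
rewrite natr_sum sum_convolution /pairs_outside.
apply: eq_bigr => a aA; apply: eq_bigr => b bA.
by rewrite !inE imset2_f // andbT.
Qed.

(** If [s = a + b] with [a != b], the convolution counts both orders; if [a = b], the diagonal sum
    supplies the second unit. *)
Lemma convolution_diag_ge2 A (s : F) :
  s \in sumset A A -> 2 <= (convolution A A s)%:R + \sum_(a in A) (a + a == s)%:R :> int.
Proof.
case/imset2P => a b aA bA ->; rewrite convolution_card.
rewrite (bigD1 a) //= [a + b]addrC addrK bA.
have [->|ab] := eqVneq b a.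
  rewrite [X in _ <= _ + X](bigD1 a) //= eqxx.
  set u := \sum_(i in A | _) _; set v := \sum_(i in A | _) _.
  have u0 : 0 <= u by apply: sumr_ge0 => i _; rewrite ler0n.
  have v0 : 0 <= v by apply: sumr_ge0 => i _; rewrite ler0n.
  by lia.
rewrite (bigD1 b) /=; last by rewrite bA.
rewrite [b + a]addrC addrK aA.
set u := \sum_(i | _ && _) _; set v := \sum_(i in A) _.
have u0 : 0 <= u by apply: sumr_ge0 => i _; rewrite ler0n.
have v0 : 0 <= v by apply: sumr_ge0 => i _; rewrite ler0n.
by lia.
Qed.

(** Sum the previous bound over the sumset: the convolution totals at most [k ^ 2], the diagonal at
    most [k]. *)
Lemma card_sumset_le A : (2 * #|sumset A A| <= #|A| ^ 2 + #|A|)%N.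
Proof.
suff : 2 * #|sumset A A|%:R <= #|A|%:R ^+ 2 + #|A|%:R :> int by lia.
rewrite mulrC -sum_const.
apply: (le_trans (ler_sum _ (fun s => @convolution_diag_ge2 A s))).
rewrite big_split /= sum_convolution; apply: lerD.
  rewrite expr2 -sum_const; apply: ler_sum => a _.
  rewrite -[X in _ <= X]mulr1 -sum_const; apply: ler_sum => b _.
  by case: (_ \in _).
rewrite exchange_big -[X in _ <= X]mulr1 -sum_const /=; apply: ler_sum => a _.
rewrite big_mkcond /= -[X in _ <= X](sum_delta (a + a) (fun=> 1)).
by apply: ler_sum => s _; case: (s \in _); case: (_ == _).
Qed.

Lemma card_le_missing A :
  (#|F| <= #|A| ^ 2 + #|A| + 2 * #|quad_residues F :\: sumset A A| + 1)%N.
Proof.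
have := card_quad_residues; have := card_sumset_le A.
have := cardsID (sumset A A) (quad_residues F).
have := subset_leq_card (subsetIr (quad_residues F) (sumset A A)).
move: #|_ :&: _| #|_ :\: _| => i d le1 <- le2 ->; move: le1 le2.
move: #|sumset _ _| #|A| => s k; nia.
Qed.

(** Bounding [#|F|] by [card_le_missing] in [card_le_pairs_outside] cancels the cubes. The
    coefficient [6], source of the constant 1/6, is [2] from missing residues plus [4] from outside
    pairs. *)
Lemma card_le_max A (M : nat) :
  (#|quad_residues F :\: sumset A A| <= M)%N ->
  (\sum_(x in sumset A A :\: quad_residues F) convolution A A x <= M)%N ->
  (#|A| ^ 2 <= (6 * #|A| + 2) * M + #|A|)%N.
Proof.
have [-> //|k_gt0] := posnP #|A|.
have := card_le_missing A; have := card_le_pairs_outside A.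
rewrite -sum_convolution_outside.
set m1 := #|_ :\: _|; set m2 := (\sum_(x in _) _)%N => le2 le1 m1M m2M.
nia.
Qed.

End Character.

(** * The two claims over ['F_p] *)

Lemma Fp_two_neq0 (p : nat) : prime p -> p <> 2 -> 2%:R != 0 :> 'F_p.
Proof.
move=> p_pr p2; rewrite -(dvdn_pcharf (pchar_Fp p_pr)) dvdn_prime2 //.
exact/eqP.
Qed.

Lemma sumset_eq_quad_residues (p : nat) (A : {set 'F_p}) :
  prime p -> sumset A A = quad_residues 'F_p -> p = 3%N /\ A = [set 2%:R].
Proof.
move=> p_pr AA.
have AR a : a \in A -> a + a \in quad_residues 'F_p.
  by move=> aA; rewrite -AA imset2_f.
(* In characteristic 2, [a + a = 0] is not a residue, so [A] would be empty although [1] lies in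
   [R]. *)
have [p2|/eqP p2] := eqVneq p 2%N.
  have : 1 \in sumset A A.
    by rewrite AA inE oner_eq0; apply/existsP; exists 1; rewrite expr1n.
  case/imset2P => a b /AR; rewrite inE => /andP[/eqP aa0 _] _ _; case: aa0.
  by clear -p2; subst p; apply/val_inj; case: a => [[|[|[]]]].
have two0 := Fp_two_neq0 p_pr p2.
have cF : #|'F_p| = p by rewrite card_Fp.
have := card_le_missing two0 A; have := card_le_pairs_outside two0 A.
rewrite -sum_convolution_outside AA setDv cards0 big_set0 cF => le2 le1.
have p_gt1 := prime_gt1 p_pr.
(* With no error terms, [k ^ 2 + 2 * k <= p <= k ^ 2 + k + 1], which forces [k = 1]. *)
have [k1 p3] : #|A| = 1%N /\ p = 3%N.
  move: le1 le2; move: #|A| => k le1 le2; clear -le1 le2 p_gt1 p2.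
  have k_gt0 : (0 < k)%N by case: k le1 {le2} => //; lia.
  have : (k ^ 2 + 2 * k <= p)%N by rewrite -(leq_pmul2r k_gt0); nia.
  by move=> k_le; nia.
split=> //; have /cards1P[a Aa] : #|A| == 1%N by rewrite k1.
have : a + a \in quad_residues 'F_p by apply: AR; rewrite Aa set11.
rewrite {}Aa inE => /andP[a0 /existsP[y]].
clear -p3 a0; subst p => ay; congr [set _]; apply/val_inj.
(* In ['F_3] the only residue is [1], so [a + a = 1] and [a = 2]. *)
by case: a a0 ay => [[|[|[]]]] //= ? _; case: y => [[|[|[]]]].
Qed.

Theorem theorem14 :
  (forall (p : nat) (A : {set 'F_p}),
     prime p ->
     sumset A A = quad_residues 'F_p ->
     p = 3%N /\ A = [set 2%:R]) /\
  (forall (K : realType) (eps : K),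
     0 < eps ->
     exists p0 : nat,
       forall (p : nat) (A : {set 'F_p}),
         prime p -> (p0 < p)%N ->
         (6%:R^-1 - eps) * #|A|%:R <=
         (maxn #|quad_residues 'F_p :\: sumset A A|
               (\sum_(x in sumset A A :\: quad_residues 'F_p)
                  convolution A A x)%N)%:R).
Proof.
split=> [|K eps eps0]; first exact: sumset_eq_quad_residues.
pose k0 := Num.bound (eps^-1).
have k0P : eps^-1 < k0%:R by rewrite archi_boundP // invr_ge0 ltW.
(* Large enough to exclude [p = 2] and, when [#|A| < k0], to make [card_le_missing] yield at least
   [#|A|] missing residues. *)
exists (k0 ^ 2 + 3 * k0 + 2)%N => p A p_pr pp0.
have two0 : 2%:R != 0 :> 'F_p by apply: Fp_two_neq0 => //; lia.
set m1 := #|_ :\: _|; set m2 := (\sum_(x in _) _)%N.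
move: (maxn m1 m2) (leq_maxl m1 m2) (leq_maxr m1 m2) => M m1M m2M.
have le_max := card_le_max two0 m1M m2M.
have trivial_bound : (#|A| <= M)%N -> (6%:R^-1 - eps) * #|A|%:R <= M%:R.
  rewrite -(ler_nat K) => kM; have k_ge0 : 0 <= #|A|%:R :> K by rewrite ler0n.
  nra.
have [/trivial_bound //|ltMk] := leqP #|A| M.
have [small|large] := ltnP #|A| k0.
  apply: trivial_bound; have := card_le_missing two0 A; rewrite card_Fp //.
  have : (#|A| ^ 2 <= k0 ^ 2)%N by rewrite leq_exp2r // ltnW.
  by move: m1M pp0 small; rewrite -/m1; move: m1 #|A| => m1 k; lia.
(* Since [M < #|A|], the term [2 * M] of [le_max] is below [2 * #|A|]; then divide by [#|A|]. *)
have : (#|A| <= 6 * M + 3)%N.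
  rewrite -(leq_pmul2r (leq_ltn_trans (leq0n M) ltMk)).
  by move: le_max ltMk; move: #|A| => k; nia.
rewrite -(ler_nat K) natrD natrM => kM.
(* The choice of [k0] lets [eps * #|A|] absorb the additive error [3 / 6]. *)
have : 1 < eps * #|A|%:R.
  by rewrite -ltr_pdivrMl // mulr1 (lt_le_trans k0P) // ler_nat.
lra.
Qed.
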